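(* Let \[ C=\inf_{n\ge k\ge 1}\ \inf_{x_1,\dots,x_n>0}\ \frac{k}{n}\sum_{i=1}^n\frac{x_i}{x_{i+1}+\cdots+x_{i+k}}, \] where the outer infimum is over all pairs of integers $n\ge k\ge 1$, the inner infimum is over all positive real vectors $(x_1,\dots,x_n)$, and indices are taken modulo $n$. Then \[ C=\log 2 . \]
   Context: Indices are cyclic: $x_{i+n}=x_i$. The endpoint case $k=n$ is allowed. $\log$ denotes the natural logarithm. *)

(* Defs.v *)
From mathcomp Require Import all_boot all_order all_algebra.
From mathcomp Require Import all_classical all_reals all_analysis.

Set Implicit Arguments.
Unset Strict Implicit.
Unset Printing Implicit Defensive.

Import Order.TTheory GRing.Theory Num.Theory.
Local Open Scope classical_set_scope.
Local Open Scope ring_scope.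

(* The index i + j read modulo n. The variables x_1, ..., x_n are indexed by
   0, ..., n - 1. *)
Definition cyc_add (n : nat) (i : 'I_n) (j : nat) : 'I_n :=
  Ordinal (ltn_pmod (i + j) (leq_ltn_trans (leq0n i) (ltn_ord i))).

Definition cyclic_sum (R : realType) (n k : nat) (x : 'I_n -> R) : R :=
  k%:R / n%:R *
    \sum_(i < n) (x i / \sum_(1 <= j < k.+1) x (cyc_add i j)).

(* Infima are taken in the extended reals, where every set has one, so that no
   default value is involved. *)
Definition inner_inf (R : realType) (n k : nat) : \bar R :=
  ereal_inf [set (cyclic_sum k x)%:E | x in [set x : 'I_n -> R | forall i, 0 < x i]].

Definition cyclic_const (R : realType) : \bar R :=
  ereal_inf [set inner_inf R p.1 p.2 | p in [set p : nat * nat | (1 <= p.2 <= p.1)%N]].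

(* Main.v *)
(** Lower bound: let S_m(i) be the sum of the m terms from position i on and
    s(m) the sum over a period of log S_m. Since (a + S)(S + b) >= S(a + S + b),
    s is concave, and S_2k(i) = S_k(i) + S_k(i + k) with AM-GM gives
    s(2k) - s(k) >= n log 2; hence s(k + 1) - s(k) >= (n/k) log 2. Finally
    y >= log(1 + y) for y = x_i / (x_{i+1} + ... + x_{i+k}).

    Upper bound: take period p, k = p + N, n = 2p with N << p, each period being
    a cluster of N ones followed by tiny values. The window following the j-th
    one sees the N - j remaining ones and the whole next cluster, so the sum is
    close to 1/N + ... + 1/(2N - 1), which tends to log 2. *)
Require Import Defs.
From mathcomp Require Import all_boot all_order all_algebra.
From mathcomp Require Import all_classical all_reals all_analysis.
From mathcomp Require Import zify ring lra.

Set Implicit Arguments.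
Unset Strict Implicit.
Unset Printing Implicit Defensive.

Import Order.TTheory GRing.Theory Num.Theory.
Local Open Scope ring_scope.

(** * Window sums of periodic sequences *)

Definition window (R : realType) (X : nat -> R) (m i : nat) : R :=
  \sum_(i <= t < i + m) X t.

Lemma window_recr (R : realType) (X : nat -> R) (m i : nat) :
  window X m.+1 i = window X m i + X (i + m)%N.
Proof. by rewrite /window addnS big_nat_recr ?leq_addr. Qed.

Lemma window_recl (R : realType) (X : nat -> R) (m i : nat) :
  window X m.+1 i = X i + window X m i.+1.
Proof. by rewrite /window big_ltn ?addSnnS // -addSnnS ltnS leq_addr. Qed.

Lemma windowD (R : realType) (X : nat -> R) (a b i : nat) :
  window X (a + b) i = window X a i + window X b (i + a).
Proof. by rewrite /window (@big_cat_nat _ _ _ (i + a)) ?addnA ?leq_addr. Qed.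

Lemma window_gt0 (R : realType) (X : nat -> R) (m i : nat) :
  (forall t, 0 < X t) -> (0 < m)%N -> 0 < window X m i.
Proof.
move=> X0; case: m => // m _; rewrite window_recl ltr_pwDl //.
by apply: sumr_ge0 => t _; apply: ltW.
Qed.

Lemma window_periodic (R : realType) (X : nat -> R) (n m i : nat) :
  (forall t, X (t + n)%N = X t) -> window X m (i + n) = window X m i.
Proof.
move=> pX; rewrite /window addnAC big_addn addnK.
by apply: eq_bigr => t _; rewrite pX.
Qed.

(** Moving the start by one trades [X s] for [X (s + n)], which are equal. *)
Lemma window_full_period (R : realType) (X : nat -> R) (n s : nat) :
  (forall t, X (t + n)%N = X t) -> window X n s = window X n 0.
Proof.
move=> pX; elim: s => // s <-; apply: (@addrI _ (X s)).
by rewrite -window_recl window_recr pX addrC.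
Qed.

Lemma sum_periodic_shift (R : realType) (f : nat -> R) (n s : nat) :
  (forall t, f (t + n)%N = f t) ->
  \sum_(0 <= i < n) f (i + s)%N = \sum_(0 <= i < n) f i.
Proof.
move=> pf; have := window_full_period s pf; rewrite /window add0n => <-.
by rewrite -{2}[s]add0n big_addn addKn.
Qed.

(** * Lower bound: logarithms of window sums *)

Definition log_sum (R : realType) (X : nat -> R) (n m : nat) : R :=
  \sum_(0 <= i < n) ln (window X m i).

Lemma log_sum_shift (R : realType) (X : nat -> R) (n m s : nat) :
  (forall t, X (t + n)%N = X t) ->
  \sum_(0 <= i < n) ln (window X m (i + s)) = log_sum X n m.
Proof.
move=> pX; rewrite (@sum_periodic_shift _ (fun i => ln (window X m i))) //.
by move=> t; rewrite window_periodic.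
Qed.

Lemma log_sum_concave (R : realType) (X : nat -> R) (n m : nat) :
  (forall t, 0 < X t) -> (forall t, X (t + n)%N = X t) -> (0 < m)%N ->
  log_sum X n m + log_sum X n m.+2 <= log_sum X n m.+1 + log_sum X n m.+1.
Proof.
move=> X0 pX m0.
(* Shifting two of the four sums by one position makes the inequality hold termwise: with S the m
   terms common to all windows and a, b their two neighbours, the products differ by exactly ab. *)
rewrite -{1}(@log_sum_shift _ X n m 1) // -{2}(@log_sum_shift _ X n m.+1 1) //.
rewrite -!big_split /=; apply: ler_sum => i _; rewrite addn1.
have W0 j l : (0 < j)%N -> 0 < window X j l by exact: window_gt0.
rewrite -!lnM ?posrE ?W0 // ler_ln ?posrE ?mulr_gt0 ?W0 //.
rewrite (window_recl X m.+1) (window_recr X m i.+1) (window_recl X m).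
have := X0 i; have := X0 (i.+1 + m)%N; have := W0 m i.+1 m0.
move: (X i) (X _) (window _ _ _) => a b S S0 b0 a0; nra.
Qed.

Lemma log_sum_double (R : realType) (X : nat -> R) (n k : nat) :
  (forall t, 0 < X t) -> (forall t, X (t + n)%N = X t) -> (0 < k)%N ->
  n%:R * ln 2 + log_sum X n k <= log_sum X n (k + k).
Proof.
move=> X0 pX k0.
have W0 l : 0 < window X k l by exact: window_gt0.
(* Twice the claim, so that AM-GM takes the root-free form 4ab <= (a + b)^2. *)
suff : \sum_(0 <= i < n)
    (ln 2 + ln 2 + (ln (window X k i) + ln (window X k (i + k)))) <=
  \sum_(0 <= i < n) (ln (window X (k + k) i) + ln (window X (k + k) i)).
  rewrite !big_split /= log_sum_shift // sumr_const_nat subn0 -/(log_sum X n k).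
  rewrite -/(log_sum X n (k + k)) -mulr_natl; lra.
apply: ler_sum => i _; rewrite windowD.
have := W0 i; have := W0 (i + k)%N.
move: (window _ _ _) (window _ _ _) => a b a0 b0.
rewrite -!lnM ?posrE ?addr_gt0 ?mulr_gt0 //.
rewrite ler_ln ?posrE ?mulr_gt0 ?addr_gt0 //.
have := sqr_ge0 (a - b); rewrite expr2; lra.
Qed.

(* Concavity bounds the increments over [k, 2k] by the first one. *)
Lemma log_sum_increment (R : realType) (X : nat -> R) (n k : nat) :
  (forall t, 0 < X t) -> (forall t, X (t + n)%N = X t) -> (0 < k)%N ->
  n%:R * ln 2 <= k%:R * (log_sum X n k.+1 - log_sum X n k).
Proof.
move=> X0 pX k0; set s := log_sum X n.
have incr j : s (k + j).+1 - s (k + j)%N <= s k.+1 - s k.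
  elim: j => [|j IH]; first by rewrite addn0.
  apply: le_trans IH; rewrite addnS.
  have := @log_sum_concave _ X n (k + j) X0 pX; rewrite addn_gt0 k0 => /(_ isT).
  rewrite -/s; lra.
have tot j : s (k + j)%N - s k <= j%:R * (s k.+1 - s k).
  elim: j => [|j IH]; first by rewrite addn0 subrr mul0r.
  rewrite addnS -natr1 mulrDl mul1r; have := incr j; lra.
have := @log_sum_double _ X n k X0 pX k0; have := tot k; rewrite /s; lra.
Qed.

Lemma cyclic_sum_ge_ln2 (R : realType) (X : nat -> R) (n k : nat) :
  (forall t, 0 < X t) -> (forall t, X (t + n)%N = X t) -> (0 < k)%N ->
  n%:R * ln 2 <= k%:R * \sum_(0 <= i < n) (X i / window X k i.+1).
Proof.
move=> X0 pX k0; apply: le_trans (log_sum_increment X0 pX k0) _.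
(* The shift aligns both windows on the same k terms, so that their quotient is 1 + y with y the
   summand of the cyclic sum. *)
rewrite ler_wpM2l // -(@log_sum_shift _ X n k 1) // /log_sum -sumrB.
apply: ler_sum => i _; rewrite addn1.
have S0 : 0 < window X k i.+1 by exact: window_gt0.
rewrite -ln_div ?posrE ?window_gt0 // window_recl mulrDl divff ?gt_eqF //.
rewrite addrC; apply: le_ln1Dx; apply: lt_trans (divr_gt0 (X0 i) S0).
by rewrite oppr_lt0.
Qed.

(** Passes from indices modulo [n] to a periodic sequence on the naturals, whose windows may run
    past [n]. *)
Lemma cyclic_sum_window (R : realType) (X : nat -> R) (n k : nat)
    (x : 'I_n -> R) :
  (forall t, X (t + n)%N = X t) -> (forall i, x i = X i) ->
  cyclic_sum k x = k%:R / n%:R * \sum_(0 <= i < n) (X i / window X k i.+1).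
Proof.
move=> pX xX; rewrite /cyclic_sum big_mkord; congr (_ * _).
apply: eq_bigr => i _; rewrite xX; congr (_ / _).
have XM t q : X (t + q * n)%N = X t.
  by elim: q => [|q IH]; rewrite ?mul0n ?addn0 // mulSn addnCA addnC pX.
rewrite /window -[in RHS]add1n big_addn.
have -> : (1 + i + k - i = k.+1)%N by lia.
apply: eq_bigr => j _; rewrite xX /= addnC.
by rewrite [in RHS](divn_eq (j + i) n) [in RHS]addnC XM.
Qed.

Lemma ln2_le_cyclic_sum (R : realType) (n k : nat) (x : 'I_n -> R) :
  (0 < k)%N -> (0 < n)%N -> (forall i, 0 < x i) -> ln 2 <= cyclic_sum k x.
Proof.
move=> k0 n0 x0.
pose X t := x (Ordinal (ltn_pmod t n0)).
have pX t : X (t + n)%N = X t.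
  by congr x; apply: val_inj; rewrite /= modnDr.
rewrite (@cyclic_sum_window _ X) //; last first.
  by move=> i; congr x; apply: val_inj; rewrite /= modn_small.
have n0' : 0 < n%:R :> R by rewrite ltr0n.
rewrite mulrAC ler_pdivlMr // mulrC; apply: cyclic_sum_ge_ln2 => // t.
exact: x0.
Qed.

(** * Upper bound: harmonic sums and clusters *)

(** This is ln (1 + u) <= u at u = -1/(m + 1). *)
Lemma inv_le_ln_increment (R : realType) (m : nat) :
  (0 < m)%N -> (m.+1%:R)^-1 <= ln m.+1%:R - ln m%:R :> R.
Proof.
move=> m0; have := @le_ln1Dx R (- (m.+1%:R)^-1).
have -> : 1 + - (m.+1%:R)^-1 = m%:R / m.+1%:R :> R.
  by rewrite -natr1; field; rewrite natr1 pnatr_eq0.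
rewrite ln_div ?posrE ?ltr0n // ltrN2 invf_lt1 ?ltr0n // ltr1n ltnS m0.
by move=> /(_ isT); rewrite lerNr opprB.
Qed.

Lemma harmonic_dyadic_block (R : realType) (N : nat) :
  (0 < N)%N -> \sum_(N <= m < N + N) (m%:R)^-1 <= ln 2 + (N%:R)^-1 :> R.
Proof.
move=> N0; have N0' : 0 < N%:R :> R by rewrite ltr0n.
(* Logarithmic increments bound the terms from N + 1 to N + d; the difference of inverses corrects
   for a range that starts and ends one earlier. *)
have H d : \sum_(N <= m < N + d) (m%:R)^-1 <=
    (N%:R)^-1 - ((N + d)%:R)^-1 + (ln (N + d)%:R - ln N%:R) :> R.
  elim: d => [|d IH]; first by rewrite addn0 big_geq // !subrr addr0.
  rewrite addnS big_nat_recr ?leq_addr //=.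
  have := @inv_le_ln_increment R (N + d); rewrite addn_gt0 N0 => /(_ isT).
  by move: IH; move: (_.+1%:R^-1) (ln _.+1%:R) => u v; lra.
apply: le_trans (H N) _.
have -> : (N + N)%:R = 2 * N%:R :> R by rewrite addnn -mul2n natrM.
rewrite lnM ?posrE //.
have : 0 <= (2 * N%:R)^-1 :> R by rewrite invr_ge0 mulr_ge0 ?ltW.
lra.
Qed.

Definition clusters (R : realType) (p N : nat) (e : R) (t : nat) : R :=
  if (t %% p < N)%N then 1 else e.

Lemma clusters_gt0 (R : realType) (p N : nat) (e : R) t :
  0 < e -> 0 < clusters p N e t.
Proof. by rewrite /clusters; case: ifP. Qed.

Lemma clusters_periodic (R : realType) (p N : nat) (e : R) t :
  clusters p N e (t + p) = clusters p N e t.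
Proof. by rewrite /clusters modnDr. Qed.

(* The window following a position [i] contains what remains of the cluster of
   [i] and the whole next cluster; the subtraction is truncated. *)
Lemma clusters_window_ge (R : realType) (p N i : nat) (e : R) :
  0 < e -> (N <= p)%N -> (i < p)%N ->
  (N + (N - i.+1))%:R <= window (clusters p N e) (p + N) i.+1.
Proof.
move=> e0 Np ip; rewrite /window.
have ge0 a b : 0 <= \sum_(a <= t < b) clusters p N e t.
  by apply: sumr_ge0 => t _; apply/ltW/clusters_gt0.
have count a b : (forall t, (a <= t < b)%N -> (t %% p < N)%N) ->
    \sum_(a <= t < b) clusters p N e t = (b - a)%:R.
  move=> h; rewrite -sumr_const_nat; apply: eq_big_nat => t /h.
  by rewrite /clusters => ->.
(* Cut at the end of the current cluster and at both ends of the next one; with [maxn] the first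
   piece is empty when [i] lies past the cluster. *)
rewrite (@big_cat_nat _ _ _ (maxn i.+1 N)) /=; [|lia|lia].
rewrite (@big_cat_nat _ _ _ p (maxn i.+1 N)) /=; [|lia|lia].
rewrite (@big_cat_nat _ _ _ (p + N) p) /=; [|lia|lia].
rewrite (count i.+1); last by move=> t h; rewrite modn_small; lia.
rewrite (count p); last first.
  move=> t h; have -> : t = (t - p + p)%N by lia.
  by rewrite modnDr modn_small; lia.
have -> : (maxn i.+1 N - i.+1 = N - i.+1)%N by lia.
rewrite addKn natrD.
have := ge0 (maxn i.+1 N) p; have := ge0 (p + N)%N (i.+1 + (p + N))%N; lra.
Qed.

Lemma clusters_sum_le (R : realType) (p N : nat) (e : R) :
  0 < e -> (0 < N <= p)%N ->
  \sum_(0 <= i < p)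
    (clusters p N e i / window (clusters p N e) (p + N) i.+1) <=
  ln 2 + (N%:R)^-1 + p%:R * e / N%:R.
Proof.
move=> e0 /andP[N0 Np].
have N0' : 0 < N%:R :> R by rewrite ltr0n.
rewrite (@big_cat_nat _ _ _ N) //=; apply: lerD.
  apply: le_trans (harmonic_dyadic_block R N0).
  have -> : \sum_(N <= m < N + N) (m%:R)^-1 =
      \sum_(0 <= i < N) ((i + N)%:R)^-1 :> R.
    by rewrite -{1}[N]add0n big_addn addnK.
  (* Reversed, since the windows after successive ones lose one term of the cluster at a time. *)
  rewrite [leRHS]big_nat_rev /=.
  apply: ler_sum_nat => i /andP[_ iN]; rewrite add0n [(_ - _ + N)%N]addnC.
  have -> : clusters p N e i = 1.
    by rewrite /clusters modn_small ?(leq_trans iN) // iN.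
  rewrite div1r.
  rewrite lef_pV2 ?posrE ?ltr0n ?addn_gt0 ?N0 //.
    by apply: clusters_window_ge => //; apply: leq_trans Np.
  by apply: window_gt0; [move=> t; exact: clusters_gt0 | rewrite addn_gt0 N0 orbT].
(* Outside the cluster the numerator is [e], and the window still contains a whole cluster. *)
apply: (@le_trans _ _ (\sum_(N <= i < p) (e / N%:R))).
  apply: ler_sum_nat => i /andP[Ni ip].
  have -> : clusters p N e i = e.
    by rewrite /clusters modn_small // ltnNge Ni.
  rewrite ler_pM2l // lef_pV2 ?posrE //.
    by apply: le_trans (clusters_window_ge e0 Np ip); rewrite ler_nat leq_addr.
  by apply: window_gt0; [move=> t; exact: clusters_gt0 | rewrite addn_gt0 N0 orbT].
rewrite sumr_const_nat -[leLHS]mulr_natl mulrA !ler_pM2r ?invr_gt0 //.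
by rewrite ler_nat leq_subr.
Qed.

(** Two periods are taken because the window length p + N exceeds p when N > 0, while k <= n must
    hold; both contribute equally. *)
Lemma cyclic_sum_clusters (R : realType) (p N : nat) (e : R) :
  (0 < p)%N ->
  cyclic_sum (p + N) (fun i : 'I_(p + p) => clusters p N e i) =
  (p + N)%:R / p%:R * \sum_(0 <= i < p)
    (clusters p N e i / window (clusters p N e) (p + N) i.+1).
Proof.
move=> p0; set X := clusters p N e.
have pX t : X (t + p)%N = X t by exact: clusters_periodic.
rewrite (@cyclic_sum_window _ X) //; last by move=> t; rewrite addnA !pX.
pose F i := X i / window X (p + N) i.+1.
have pF t : F (t + p)%N = F t by rewrite /F pX -addSn window_periodic.
have -> : \sum_(0 <= i < p + p) F i = window F p 0 + window F p 0.
  by rewrite -[LHS]/(window F (p + p) 0) windowD (window_full_period _ pF).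
rewrite -[\sum_(_ <= _ < _) _]/(window F p 0).
have p0' : 0 < p%:R :> R by rewrite ltr0n.
rewrite natrD; field; lra.
Qed.

Lemma cyclic_sum_near_ln2 (R : realType) (N : nat) :
  (0 < N)%N -> exists2 x : 'I_(N ^ 2 + N ^ 2) -> R, (forall i, 0 < x i) &
    cyclic_sum (N ^ 2 + N) x <= ln 2 + 5 / N%:R.
Proof.
move=> N0; have N0' : 0 < N%:R :> R by rewrite ltr0n.
have p0 : (0 < N ^ 2)%N by rewrite expn_gt0 N0.
have e0 : 0 < (N%:R ^+ 2)^-1 :> R by rewrite invr_gt0 exprn_gt0.
(* With p = N^2 and e = 1/p, both k/p - 1 and p e/N equal 1/N. *)
exists (fun i => clusters (N ^ 2) N (N%:R ^+ 2)^-1 i).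
  by move=> i; exact: clusters_gt0.
rewrite cyclic_sum_clusters //.
have NN : (0 < N <= N ^ 2)%N by rewrite N0 /= leq_pmulr.
have := clusters_sum_le e0 NN; move: (\sum_(_ <= _ < _) _) => S.
rewrite natrD natrX divff ?gt_eqF ?exprn_gt0 // div1r => HS.
have -> : (N%:R ^+ 2 + N%:R) / N%:R ^+ 2 = 1 + (N%:R)^-1 :> R.
  by field; rewrite gt_eqF.
have u1 : (N%:R)^-1 <= 1 :> R by rewrite invf_le1 // ler1n.
have u0 : 0 < (N%:R)^-1 :> R by rewrite invr_gt0.
have l2 : ln 2 <= 1 :> R by have := @le_ln1Dx R 1; apply; lra.
(* For u <= 1, (1 + u)(ln 2 + 2u) <= ln 2 + 5u, using ln 2 <= 1. *)
move: (N%:R)^-1 u0 u1 HS => u u0 u1 HS; nra.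
Qed.

Theorem theorem14p3 (R : realType) : cyclic_const R = (ln (2 : R))%:E.
Proof.
apply/eqP; rewrite eq_le; apply/andP; split.
  apply/lee_addgt0Pr => e e0.
  have [N N0 eN] : exists2 N, (0 < N)%N & 5 / e <= N%:R.
    have /archi_boundP/ltW h : 0 <= 5 / e by rewrite divr_ge0 // ltW.
    by exists (Num.bound (5 / e)).+1; rewrite // (le_trans h) ?ler_nat.
  have [x x0 hx] := @cyclic_sum_near_ln2 R N N0.
  apply: ge_ereal_inf; exists (inner_inf R (N ^ 2 + N ^ 2) (N ^ 2 + N)).
    exists (N ^ 2 + N ^ 2, N ^ 2 + N)%N => //=.
    by rewrite addn_gt0 N0 orbT leq_add2l leq_pmulr.
  apply: ge_ereal_inf; exists (cyclic_sum (N ^ 2 + N) x)%:E; first by exists x.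
  rewrite lee_fin; apply: le_trans hx _; rewrite lerD2l.
  by rewrite ler_pdivrMr ?ltr0n // mulrC -ler_pdivrMr.
apply/ereal_infP => _ [[n k] /= /andP[k0 kn] <-].
apply/ereal_infP => _ [x /= x0 <-].
rewrite lee_fin; apply: ln2_le_cyclic_sum => //; exact: leq_trans kn.
Qed.
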